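(* Let $k\ge2$, let $\Gamma_k$ be the fundamental group of a closed oriented surface of genus $k$, $\mathbb{C}\Gamma_k$ its group $*$-algebra and $\varepsilon\colon\mathbb{C}\Gamma_k\to\mathbb{C}$ the linear extension of the trivial representation. Then $(\mathbb{C}\Gamma_k,\varepsilon)$ does not have property (NC).
   Context: $\Gamma_k=\langle a_1,\ldots,a_k,b_1,\ldots,b_k\mid a_1b_1a_1^{-1}b_1^{-1}\cdots a_kb_ka_k^{-1}b_k^{-1}\rangle$; the group $*$-algebra has involution $g^*=g^{-1}$, and $\varepsilon(g)=1$ for all group elements $g$. Put $A=\mathbb{C}\Gamma_k$. A pre-Hilbert space is a complex vector space $D$ with a positive definite inner product, linear in the second argument; $L(D)$ is the $*$-algebra of adjointable linear operators $D\to D$. For a unital $*$-representation $\pi\colon A\to L(D)$, a $\pi$-$\varepsilon$-cocycle is a linear map $\eta\colon A\to D$ with $\eta(ab)=\pi(a)\eta(b)+\eta(a)\varepsilon(b)$ for all $a,b\in A$. A Schürmann triple is a triple $(\pi,\eta,\psi)$ of such $\pi,\eta$ and a linear functional $\psi\colon A\to\mathbb{C}$ with $\psi(a^* )=\overline{\psi(a)}$ and $\varepsilon(a)\psi(b)-\psi(ab)+\psi(a)\varepsilon(b)=-\langle\eta(a^* ),\eta(b)\rangle$ for all $a,b\in A$. Given $(\pi,\eta)$, replace $D$ by the $\pi$-invariant subspace $\eta(A)$ so that $\eta$ is surjective; let $H$ be the completion of $D$, $P_G$ the orthogonal projection of $H$ onto $H_G=\{(\pi(a)-\varepsilon(a))v: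 a\in A, v\in D\}^\perp$, and $D_G=P_GD$. The cocycle is called (purely) non-Gaussian if $D_G=\{0\}$. Property (NC): every pair $(\pi,\eta)$ of a unital $*$-representation $\pi$ on a pre-Hilbert space and a $\pi$-$\varepsilon$-cocycle $\eta$ with $D_G=\{0\}$ can be completed to a Schürmann triple $(\pi,\eta,\psi)$. *)

(* Defs.v *)
From HB Require Import structures.
#[warnings="-notation-overridden,-ambiguous-paths,-notation-incompatible-prefix"]
From mathcomp Require Import all_boot all_order all_algebra.
#[warnings="-notation-overridden,-ambiguous-paths,-notation-incompatible-prefix"]
From mathcomp Require Import finmap generic_quotient.
From mathcomp Require Import boolp classical_sets reals.
From mathcomp Require Import complex.
#[warnings="-notation-overridden,-ambiguous-paths,-notation-incompatible-prefix"]
From mathcomp.multinomials Require Import monalg.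

Set Implicit Arguments.
Unset Strict Implicit.
Unset Printing Implicit Defensive.

Import Order.TTheory GRing.Theory Num.Theory.
Local Open Scope classical_set_scope.
Local Open Scope quotient_scope.
Local Open Scope ring_scope.

(* Words over X and formal inverses: (x, false) is the letter x and
   (x, true) is its inverse. *)
Notation word X := (seq (X * bool)).

Definition winv (X : choiceType) (w : word X) : word X :=
  rev [seq (l.1, ~~ l.2) | l <- w].

Inductive word_eqv (X : choiceType) (rel : set (word X)) :
    word X -> word X -> Prop :=
  | word_eqv_refl w : word_eqv rel w w
  | word_eqv_sym v w : word_eqv rel v w -> word_eqv rel w v
  | word_eqv_trans u v w :
      word_eqv rel u v -> word_eqv rel v w -> word_eqv rel u w
  | word_eqv_cat u u' v v' :
      word_eqv rel u u' -> word_eqv rel v v' ->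
      word_eqv rel (u ++ v) (u' ++ v')
  | word_eqv_cancel x b : word_eqv rel [:: (x, b); (x, ~~ b)] [::]
  | word_eqv_rel r : rel r -> word_eqv rel r [::].

Section PresentedGroup.
Context {X : choiceType} (rel : set (word X)).

Definition word_eqvb (v w : word X) : bool := `[< word_eqv rel v w >].

Lemma word_eqvb_refl : reflexive word_eqvb.
Proof. by move=> w; apply/asboolP; exact: word_eqv_refl. Qed.

Lemma word_eqvb_sym : symmetric word_eqvb.
Proof.
by move=> v w; apply/idP/idP => /asboolP h; apply/asboolP; exact: word_eqv_sym.
Qed.

Lemma word_eqvb_trans : transitive word_eqvb.
Proof.
move=> v u w /asboolP h1 /asboolP h2; apply/asboolP.
exact: (word_eqv_trans h1 h2).
Qed.

Canonical word_equiv :=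
  EquivRel word_eqvb word_eqvb_refl word_eqvb_sym word_eqvb_trans.

Definition presented : Type := {eq_quot word_equiv}.

HB.instance Definition _ := Choice.on presented.
HB.instance Definition _ := EqQuotient.on presented.

Definition wclass (w : word X) : presented := \pi w.

Lemma wclassP v w : wclass v = wclass w <-> word_eqv rel v w.
Proof. by split=> [/eqquotP/asboolP//|h]; apply/eqquotP/asboolP. Qed.

Lemma wclass_repr (g : presented) : wclass (repr g) = g.
Proof. exact: reprK. Qed.

Lemma repr_wclass w : word_eqv rel (repr (wclass w)) w.
Proof. by apply/wclassP; rewrite wclass_repr. Qed.

Definition pres_one : presented := wclass [::].
Definition pres_mul (g h : presented) : presented :=
  wclass (repr g ++ repr h).
Definition pres_inv (g : presented) : presented := wclass (winv (repr g)).

Lemma pres_mulE v w : pres_mul (wclass v) (wclass w) = wclass (v ++ w).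
Proof. by apply/wclassP; apply: word_eqv_cat; exact: repr_wclass. Qed.

Lemma winv_cons (l : X * bool) (w : word X) :
  winv (l :: w) = winv w ++ [:: (l.1, ~~ l.2)].
Proof. by rewrite /winv /= rev_cons cats1. Qed.

Lemma winvK : involutive (@winv X).
Proof.
move=> w; rewrite /winv map_rev revK -map_comp -[RHS]map_id.
by apply: eq_map => -[x b] /=; rewrite negbK.
Qed.

Lemma word_eqv_mulV (w : word X) : word_eqv rel (w ++ winv w) [::].
Proof.
elim: w => [|[x b] w IHw]; first exact: word_eqv_refl.
rewrite winv_cons -cat1s -catA (catA w).
apply: (@word_eqv_trans _ _ _ ([:: (x, b)] ++ [::] ++ [:: (x, ~~ b)])).
  apply: word_eqv_cat; first exact: word_eqv_refl.
  by apply: word_eqv_cat IHw _; exact: word_eqv_refl.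
exact: word_eqv_cancel.
Qed.

Lemma pres_mulA : associative pres_mul.
Proof.
move=> f g h; rewrite -(wclass_repr f) -(wclass_repr g) -(wclass_repr h).
by rewrite !pres_mulE catA.
Qed.

Lemma pres_mul1 : left_id pres_one pres_mul.
Proof. by move=> g; rewrite -(wclass_repr g) pres_mulE. Qed.

Lemma pres_mulg1 : right_id pres_one pres_mul.
Proof. by move=> g; rewrite -(wclass_repr g) pres_mulE cats0. Qed.

Lemma pres_mulgV : right_inverse pres_one pres_inv pres_mul.
Proof.
move=> g; rewrite -{1}(wclass_repr g) pres_mulE.
by apply/wclassP; exact: word_eqv_mulV.
Qed.

Lemma pres_mulVg : left_inverse pres_one pres_inv pres_mul.
Proof.
move=> g; rewrite -{2}(wclass_repr g) pres_mulE; apply/wclassP.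
by rewrite -{2}(winvK (repr g)); exact: word_eqv_mulV.
Qed.

HB.instance Definition _ := isGroup.Build presented
  pres_mulA pres_mul1 pres_mulg1 pres_mulVg pres_mulgV.

End PresentedGroup.

(* Generators of the surface group: (i, false) is a_i, (i, true) is b_i. *)
Definition surface_relator (k : nat) : word ('I_k * bool) :=
  flatten [seq [:: ((i, false), false); ((i, true), false);
                   ((i, false), true); ((i, true), true)] | i <- enum 'I_k].

Definition surface_group (k : nat) : groupType :=
  presented [set surface_relator k].

HB.mixin Record Algebra_isStar (C : numClosedFieldType) A
    of GRing.Algebra C A := {
  star : A -> A;
  starK : involutive star;
  starD : {morph star : a b / a + b};
  starZ : forall (c : C) a, star (c *: a) = c^* *: star a;
  starM : forall a b, star (a * b) = star b * star a
}.

#[short(type="starAlgType")]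
HB.structure Definition StarAlgebra (C : numClosedFieldType) :=
  { A of Algebra_isStar C A & GRing.Algebra C A }.

(* {malg C[G]} has the module structure of finitely supported functions, but its
   library product only covers monoids without nontrivial units; the convolution
   product is put on an alias. *)
Definition group_algebra (C : nzRingType) (G : groupType) : Type := {malg C[G]}.

Section LinearExtension.
Context {C : nzRingType} {G : groupType} {V : zmodType} (F : G -> C -> V)
  (F0 : forall g, F g 0 = 0).

Lemma gsum_widen (d : {fset G}) (a : {malg C[G]}) : (msupp a `<=` d)%fset ->
  \sum_(g <- msupp a) F g a@_g = \sum_(g <- d) F g a@_g.
Proof.
by move=> le; apply: big_fset_incl => // g _ /mcoeff_outdom ->; rewrite F0.
Qed.

Lemma gsumU c g : \sum_(h <- msupp << c *g g >>) F h (<< c *g g >>@_h) = F g c.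
Proof.
by rewrite (gsum_widen (msuppU_le (k := g))) big_seq_fset1 mcoeffUU.
Qed.

Lemma gsumD (FD : forall g, {morph F g : x y / x + y}) (a b : {malg C[G]}) :
  \sum_(g <- msupp (a + b)) F g (a + b)@_g =
  \sum_(g <- msupp a) F g a@_g + \sum_(g <- msupp b) F g b@_g.
Proof.
rewrite (gsum_widen (msuppD_le a b)).
rewrite (gsum_widen (fsubsetUl (msupp a) (msupp b))).
rewrite (gsum_widen (fsubsetUr (msupp a) (msupp b))) -big_split /=.
by apply: eq_bigr => g _; rewrite mcoeffD FD.
Qed.

Lemma gsumZ (c : C) (a : {malg C[G]}) :
  \sum_(g <- msupp (c *: a)) F g (c *: a)@_g =
  \sum_(g <- msupp a) F g (c * a@_g).
Proof.
rewrite (gsum_widen (msuppZ_le c a)).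
by apply: eq_bigr => g _; rewrite mcoeffZ.
Qed.

End LinearExtension.

Lemma malg_ext (C : nzRingType) (G : groupType) (V : zmodType)
    (f1 f2 : {malg C[G]} -> V) :
  {morph f1 : a b / a + b} -> {morph f2 : a b / a + b} ->
  (forall x g, f1 << x *g g >> = f2 << x *g g >>) -> f1 =1 f2.
Proof.
move=> f1D f2D f12 a.
have f10 : f1 0 = 0 by apply: (addrI (f1 0)); rewrite -f1D !addr0.
have f20 : f2 0 = 0 by apply: (addrI (f2 0)); rewrite -f2D !addr0.
rewrite [a]monalgE (big_morph f1 f1D f10) (big_morph f2 f2D f20).
by apply: eq_bigr => g _; exact: f12.
Qed.

Section GroupAlgebraRing.
Context (C : nzRingType) (G : groupType).
Notation A := (group_algebra C G).

HB.instance Definition _ := GRing.Lmodule.copy A {malg C[G]}.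

Definition gone : A := << 1%g >>.

Definition gmul (a b : A) : A :=
  \sum_(g <- msupp a) \sum_(h <- msupp b) << a@_g * b@_h *g (g * h)%g >>.

Lemma gmul_inner0 (b : A) g :
  \sum_(h <- msupp b) << 0 * b@_h *g (g * h)%g >> = 0 :> A.
Proof. by rewrite big1 // => h _; rewrite mul0r monalgU0. Qed.

Lemma gmulDl : left_distributive gmul +%R.
Proof.
move=> a b c; rewrite /gmul.
apply: (gsumD (F := fun g x =>
  \sum_(h <- msupp c) << x * c@_h *g (g * h)%g >> : A)).
  by move=> g; exact: gmul_inner0.
move=> g x y; rewrite -big_split; apply: eq_bigr => h _.
by rewrite mulrDl monalgUD.
Qed.

Lemma gmulDr : right_distributive gmul +%R.
Proof.
move=> a b c; rewrite /gmul -big_split; apply: eq_bigr => g _ /=.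
apply: (gsumD (F := fun h x => << a@_g * x *g (g * h)%g >> : A)).
  by move=> h; rewrite mulr0 monalgU0.
by move=> h x y; rewrite mulrDr monalgUD.
Qed.

Lemma gmulUU x y g h :
  gmul << x *g g >> << y *g h >> = << x * y *g (g * h)%g >>.
Proof.
rewrite /gmul (gsumU (F := fun g x => \sum_(h' <- msupp << y *g h >>)
  << x * (<< y *g h >>@_h') *g (g * h')%g >> : A)); last first.
  by move=> k; exact: gmul_inner0.
rewrite (gsumU (F := fun h y => << x * y *g (g * h)%g >> : A)) // => k.
by rewrite mulr0 monalgU0.
Qed.

Lemma gmulA : associative gmul.
Proof.
move=> a b c; move: a; apply: malg_ext => [a a'|a a'|x g].
- by rewrite gmulDl.
- by rewrite !gmulDl.
move: b; apply: malg_ext => [b b'|b b'|y h].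
- by rewrite gmulDl gmulDr.
- by rewrite gmulDr gmulDl.
move: c; apply: malg_ext => [c c'|c c'|z k].
- by rewrite !gmulDr.
- by rewrite gmulDr.
by rewrite !gmulUU mulrA mulgA.
Qed.

Lemma gmul1 : left_id gone gmul.
Proof.
apply: malg_ext => // [a a'|x g]; first exact: gmulDr.
by rewrite gmulUU mul1r mul1g.
Qed.

Lemma gmulr1 : right_id gone gmul.
Proof.
apply: malg_ext => // [a a'|x g]; first exact: gmulDl.
by rewrite gmulUU mulr1 mulg1.
Qed.

Lemma gone_neq0 : gone != 0.
Proof.
by apply/eqP => /malgP/(_ 1%g)/eqP; rewrite mcoeffUU mcoeff0 oner_eq0.
Qed.

HB.instance Definition _ := GRing.Zmodule_isNzRing.Build A
  gmulA gmul1 gmulr1 gmulDl gmulDr gone_neq0.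

Lemma gscaleU c x g : c *: << x *g g >> = << c * x *g g >> :> A.
Proof. by apply/malgP => h; rewrite mcoeffZ !mcoeffU mulrnAr. Qed.

Lemma gmulrUU x y g h :
  (<< x *g g >> : A) * (<< y *g h >> : A) = << x * y *g (g * h)%g >>.
Proof. exact: gmulUU. Qed.

Lemma gscaleAl (c : C) (a b : A) : c *: (a * b) = (c *: a) * b.
Proof.
move: a; apply: malg_ext => [a a'|a a'|x g].
- by rewrite [_ * b]mulrDl scalerDr.
- by rewrite [c *: _]scalerDr [LHS]mulrDl.
move: b; apply: malg_ext => [b b'|b b'|y h].
- by rewrite [_ * (_ + _)]mulrDr scalerDr.
- by rewrite [LHS]mulrDr.
by rewrite gscaleU !gmulrUU gscaleU mulrA.
Qed.

HB.instance Definition _ := GRing.Lmodule_isLalgebra.Build C A gscaleAl.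

End GroupAlgebraRing.

Section GroupAlgebra.
Context (C : comNzRingType) (G : groupType).
Notation A := (group_algebra C G).

Lemma gscaleAr (c : C) (a b : A) : c *: (a * b) = a * (c *: b).
Proof.
move: a; apply: malg_ext => [a a'|a a'|x g].
- by rewrite [_ * b]mulrDl scalerDr.
- by rewrite [LHS]mulrDl.
move: b; apply: malg_ext => [b b'|b b'|y h].
- by rewrite [_ * (_ + _)]mulrDr scalerDr.
- by rewrite [c *: _]scalerDr [LHS]mulrDr.
by rewrite gscaleU !gmulrUU gscaleU mulrCA.
Qed.

HB.instance Definition _ := GRing.Lalgebra_isAlgebra.Build C A gscaleAr.

Definition augmentation (a : A) : C := \sum_(g <- msupp a) a@_g.

Lemma augmentationU x g : augmentation << x *g g >> = x.
Proof. exact: (gsumU (F := fun _ x => x)). Qed.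

Lemma augmentationD : {morph augmentation : a b / a + b}.
Proof. by move=> a b; exact: (gsumD (F := fun _ x => x)). Qed.

Lemma augmentationZ : scalable_for *%R augmentation.
Proof.
move=> c a; rewrite /augmentation mulr_sumr.
exact: (gsumZ (F := fun _ x => x)).
Qed.

Lemma augmentation1 : augmentation 1 = 1.
Proof. exact: augmentationU. Qed.

Lemma augmentationM : {morph augmentation : a b / a * b}.
Proof.
move=> a b; move: a; apply: malg_ext => [a a'|a a'|x g].
- by rewrite [_ * b]mulrDl augmentationD.
- by rewrite augmentationD mulrDl.
move: b; apply: malg_ext => [b b'|b b'|y h].
- by rewrite [_ * (_ + _)]mulrDr augmentationD.
- by rewrite augmentationD mulrDr.
by rewrite gmulrUU !augmentationU.
Qed.

Lemma augmentation_is_zmod_morphism : zmod_morphism augmentation.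
Proof. by move=> a b; rewrite augmentationD -scaleN1r augmentationZ mulN1r. Qed.

HB.instance Definition _ :=
  GRing.isZmodMorphism.Build A C augmentation augmentation_is_zmod_morphism.
HB.instance Definition _ :=
  GRing.isMonoidMorphism.Build A C augmentation (augmentation1, augmentationM).
HB.instance Definition _ :=
  GRing.isScalable.Build C A C *%R augmentation augmentationZ.

End GroupAlgebra.

Section GroupAlgebraStar.
Context (C : numClosedFieldType) (G : groupType).
Notation A := (group_algebra C G).

Definition gstar (a : A) : A := \sum_(g <- msupp a) << (a@_g)^* *g g^-1%g >>.

Lemma gstarU x g : gstar << x *g g >> = << x^* *g g^-1%g >>.
Proof.
apply: (gsumU (F := fun g x => << x^* *g g^-1%g >> : A)) => h.
by rewrite conjC0 monalgU0.
Qed.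

Lemma gstarD : {morph gstar : a b / a + b}.
Proof.
move=> a b; apply: (gsumD (F := fun g x => << x^* *g g^-1%g >> : A)).
  by move=> h; rewrite conjC0 monalgU0.
by move=> h x y; rewrite rmorphD monalgUD.
Qed.

Lemma gstarK : involutive gstar.
Proof.
apply: malg_ext => // [a a'|x g]; first by rewrite !gstarD.
by rewrite !gstarU conjCK invgK.
Qed.

Lemma gstarZ (c : C) a : gstar (c *: a) = c^* *: gstar a.
Proof.
move: a; apply: malg_ext => [a a'|a a'|x g].
- by rewrite scalerDr gstarD.
- by rewrite gstarD scalerDr.
by rewrite gscaleU !gstarU gscaleU rmorphM.
Qed.

Lemma gstarM a b : gstar (a * b) = gstar b * gstar a.
Proof.
move: a; apply: malg_ext => [a a'|a a'|x g].
- by rewrite [_ * b]mulrDl gstarD.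
- by rewrite gstarD mulrDr.
move: b; apply: malg_ext => [b b'|b b'|y h].
- by rewrite [_ * (_ + _)]mulrDr gstarD.
- by rewrite gstarD mulrDl.
by rewrite !gstarU !gmulrUU gstarU rmorphM invgM mulrC.
Qed.

HB.instance Definition _ :=
  Algebra_isStar.Build C A gstarK gstarD gstarZ gstarM.

Lemma augmentation_star (a : A) : augmentation (star a) = (augmentation a)^*.
Proof.
move: a; apply: malg_ext => [a a'|a a'|x g].
- by rewrite starD augmentationD.
- by rewrite augmentationD rmorphD.
by rewrite [star _]gstarU !augmentationU.
Qed.

End GroupAlgebraStar.

(* Only used with C = R[i] for R a realType; completeness below is that of
   sequences, which is the usual one in that case. *)
Section Schurmann.
Context {C : numClosedFieldType}.

(* The library's forms are linear in the first argument. *)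
Definition inner (D : lmodType C) (ip : {dot D for Num.conj}) (u v : D) : C :=
  ip v u.

(* T is an adjointable operator with adjoint S. *)
Definition has_adjoint (D : lmodType C) (ip : {dot D for Num.conj})
    (T S : D -> D) : Prop :=
  linear T /\ linear S /\ forall u v, inner ip (T u) v = inner ip u (S v).

Definition unital_star_rep (A : starAlgType C) (D : lmodType C)
    (ip : {dot D for Num.conj}) (pi : A -> D -> D) : Prop :=
  [/\ forall a, has_adjoint ip (pi a) (pi (star a)),
      forall (c : C) a b v, pi (c *: a + b) v = c *: pi a v + pi b v,
      forall v, pi 1 v = v
    & forall a b v, pi (a * b) v = pi a (pi b v)].

Definition cocycle (A : starAlgType C) (eps : A -> C) (D : lmodType C)
    (pi : A -> D -> D) (eta : A -> D) : Prop :=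
  linear eta /\
  forall a b, eta (a * b) = pi a (eta b) + eps b *: eta a.

Definition schurmann_triple (A : starAlgType C) (eps : A -> C) (D : lmodType C)
    (ip : {dot D for Num.conj}) (pi : A -> D -> D) (eta : A -> D)
    (psi : A -> C) : Prop :=
  [/\ unital_star_rep ip pi, cocycle eps pi eta, linear_for *%R psi,
      forall a, psi (star a) = (psi a)^*
    & forall a b, eps a * psi b - psi (a * b) + psi a * eps b =
                  - inner ip (eta (star a)) (eta b)].

Definition ip_norm (H : lmodType C) (ip : {dot H for Num.conj}) (x : H) : C :=
  sqrtC (inner ip x x).

Definition ip_complete (H : lmodType C) (ip : {dot H for Num.conj}) : Prop :=
  forall u : nat -> H,
    (forall e : C, 0 < e -> exists N, forall m n, (N <= m)%N -> (N <= n)%N ->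
       ip_norm ip (u m - u n) < e) ->
    exists l, forall e : C, 0 < e -> exists N, forall n, (N <= n)%N ->
      ip_norm ip (u n - l) < e.

(* (H, j) is a Hilbert space completion of the subspace S of D; the values of j
   outside S play no role. *)
Definition completion (D : lmodType C) (ip : {dot D for Num.conj}) (S : set D)
    (H : lmodType C) (ipH : {dot H for Num.conj}) (j : D -> H) : Prop :=
  [/\ ip_complete ipH,
      forall (c : C) u v, S u -> S v -> j (c *: u + v) = c *: j u + j v,
      forall u v, S u -> S v -> inner ipH (j u) (j v) = inner ip u v
    & forall (x : H) (e : C), 0 < e ->
        exists2 u, S u & ip_norm ipH (x - j u) < e].

Definition orthoproj (H : lmodType C) (ip : {dot H for Num.conj}) (M : set H)
    (P : H -> H) : Prop :=
  forall x, M (P x) /\ forall y, M y -> inner ip y (x - P x) = 0.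

(* H_G, for j : D -> H a completion of eta(A) *)
Definition gaussian_space (A : starAlgType C) (eps : A -> C) (D : lmodType C)
    (pi : A -> D -> D) (eta : A -> D) (H : lmodType C)
    (ipH : {dot H for Num.conj}) (j : D -> H) : set H :=
  [set h | forall a v, range eta v ->
     inner ipH (j (pi a v - eps a *: v)) h = 0].

(* D_G = {0}; completions are unique up to a unitary, so that it does not matter
   which one is used. *)
Definition non_gaussian (A : starAlgType C) (eps : A -> C) (D : lmodType C)
    (ip : {dot D for Num.conj}) (pi : A -> D -> D) (eta : A -> D) : Prop :=
  exists (H : lmodType C) (ipH : {dot H for Num.conj}) (j : D -> H) (P : H -> H),
    [/\ completion ip (range eta) ipH j,
        orthoproj ipH (gaussian_space eps pi eta ipH j) P
      & (P \o j) @` range eta = [set 0]].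

Definition property_NC (A : starAlgType C) (eps : A -> C) : Prop :=
  forall (D : lmodType C) (ip : {dot D for Num.conj})
    (pi : A -> D -> D) (eta : A -> D),
    unital_star_rep ip pi -> cocycle eps pi eta ->
    non_gaussian eps ip pi eta ->
    exists psi : A -> C, schurmann_triple eps ip pi eta psi.

End Schurmann.

(* Main.v *)
Require Import Defs.
From HB Require Import structures.
From mathcomp Require Import all_boot all_order all_algebra reals complex.
From mathcomp Require Import finmap boolp classical_sets lra ring.
From mathcomp.multinomials Require Import monalg.

(** Why property (NC) fails. In a Schürmann triple (pi, eta, psi) on a group
algebra, psi restricted to the group satisfies
  psi(gh) = psi(g) + psi(h) + <eta(g^-1), eta(h)>,
so the 2-cocycle <eta(g^-1), eta(h)> has to be a coboundary. For a surface group
this is detected by evaluation on the single relator, a product of commutators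
[a_i, b_i]: if eta vanishes on each of them, then psi is additive along the
relator and its value on [a_i, b_i] is psi(a_i b_i) - psi(b_i a_i), whence
  sum_i (<eta(a_i^-1), eta(b_i)> - <eta(b_i^-1), eta(a_i)>) = psi(1) = 0
([surface_obstruction]).

It remains to violate this by a non-Gaussian cocycle. One dimension suffices:
with the handles numbered from 0, let the surface group act on the complex plane by isometries z |-> z + v and
z |-> - z + v, the linear part being pi and the translation part being eta. The
handle (a_1, b_1) acts by the commuting translations z |-> z + 1 and
z |-> z + i, which contribute -2i to the sum above, and all other contributions
vanish. If a_0 acts by z |-> - z and the other generators act trivially, then
pi is a nontrivial character, so the Gaussian part vanishes
([motion_non_gaussian]). The second handle is what makes room for the
reflection: with pi trivial the cocycle would be Gaussian. *)

Set Implicit Arguments.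
Unset Strict Implicit.
Unset Printing Implicit Defensive.

Import Order.TTheory GRing.Theory Num.Theory.
Local Open Scope ring_scope.

(** * Homomorphisms out of presented groups *)

Definition word_eval (X : choiceType) (G : groupType) (f : X -> G)
    (w : word X) : G :=
  (\prod_(l <- w) (if l.2 then (f l.1)^-1 else f l.1))%g.

Lemma word_eval_cat (X : choiceType) (G : groupType) (f : X -> G) u v :
  word_eval f (u ++ v) = (word_eval f u * word_eval f v)%g.
Proof. by rewrite /word_eval big_cat. Qed.

(** The universal property of a presentation: an assignment of the letters that
kills the relators does not distinguish equivalent words. *)
Lemma word_eval_eqv (X : choiceType) (rel : set (word X)) (G : groupType)
    (f : X -> G) (fP : forall r, rel r -> word_eval f r = 1%g) u v :
  word_eqv rel u v -> word_eval f u = word_eval f v.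
Proof.
elim=> // [{}u w {}v _ -> _ -> //|{}u u' {}v v' _ uu' _ vv'|x b|r /fP ->].
- by rewrite !word_eval_cat uu' vv'.
- by rewrite /word_eval !big_cons big_nil mulg1; case: b; rewrite /= ?mulVg ?mulgV.
- by rewrite /word_eval big_nil.
Qed.

Definition presented_lift (X : choiceType) (rel : set (word X)) (G : groupType)
    (f : X -> G) (g : presented rel) : G := word_eval f (repr g).

Section PresentedLift.
Context (X : choiceType) (rel : set (word X)) (G : groupType) (f : X -> G)
  (fP : forall r, rel r -> word_eval f r = 1%g).

Lemma presented_lift_wclass w :
  presented_lift f (wclass rel w) = word_eval f w.
Proof. exact: (word_eval_eqv fP (repr_wclass rel w)). Qed.

Lemma presented_liftM (g h : presented rel) :
  presented_lift f (g * h)%g = (presented_lift f g * presented_lift f h)%g.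
Proof. by rewrite presented_lift_wclass word_eval_cat. Qed.

Lemma presented_lift_gen x : presented_lift f (wclass rel [:: (x, false)]) = f x.
Proof. by rewrite presented_lift_wclass /word_eval big_seq1. Qed.

End PresentedLift.

(** This transfers formulas for the evaluation of a word in arbitrary groups,
such as [word_eval_surface_relator], to the presented group itself. *)
Lemma wclass_word_eval (X : choiceType) (rel : set (word X)) (w : word X) :
  wclass rel w = word_eval (fun x => wclass rel [:: (x, false)]) w.
Proof.
elim: w => [|[x b] w IHw]; first by rewrite /word_eval big_nil.
rewrite -cat1s word_eval_cat -IHw -pres_mulE /word_eval big_seq1.
congr (_ * _)%g; case: b => //=; apply: (mulgI (wclass rel [:: (x, false)])).
by rewrite mulgV; apply/etrans/wclassP/word_eqv_cancel; exact: pres_mulE.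
Qed.

(** The commutator of the surface relator; [[~ g, h]] is [g^-1 * h^-1 * g * h]. *)
Definition lcommg (G : groupType) (g h : G) : G := (g * h * g^-1 * h^-1)%g.

Lemma word_eval_surface_relator (k : nat) (G : groupType) (f : 'I_k * bool -> G) :
  word_eval f (surface_relator k) =
  (\prod_(i <- enum 'I_k) lcommg (f (i, false)) (f (i, true)))%g.
Proof.
rewrite /surface_relator; elim: (enum _) => [|i s IHs].
  by rewrite /word_eval !big_nil.
by rewrite big_cons -IHs /= /word_eval !big_cons /= /lcommg !mulgA.
Qed.

Definition surface_gen (k : nat) (x : 'I_k * bool) : surface_group k :=
  wclass [set surface_relator k]%classic [:: (x, false)].

Lemma surface_relation (k : nat) :
  (\prod_(i <- enum 'I_k)
     lcommg (surface_gen (i, false)) (surface_gen (i, true)) = 1)%g.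
Proof.
rewrite -(word_eval_surface_relator (@surface_gen k)) -wclass_word_eval.
by apply/wclassP; exact: word_eqv_rel.
Qed.

(** * The group of maps z to z + v or - z + v *)

(** The pair (s, v) stands for the map sending z to (-1)^s z + v, and [pm_mul]
is composition of maps. *)
Definition pm_motion (C : nzRingType) : Type := (bool * C)%type.

Section PmMotion.
Context {C : nzRingType}.
HB.instance Definition _ := Choice.on (pm_motion C).
Implicit Types x y z : pm_motion C.

Definition pm_mul x y : pm_motion C := (x.1 (+) y.1, (-1) ^+ x.1 * y.2 + x.2).
Definition pm_one : pm_motion C := (false, 0).
Definition pm_inv x : pm_motion C := (x.1, - ((-1) ^+ x.1 * x.2)).

Lemma pm_mulA : associative pm_mul.
Proof.
move=> x y z; rewrite /pm_mul /= addbA; congr pair.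
by rewrite signr_addb mulrDr mulrA addrA.
Qed.

Lemma pm_mul1 : left_id pm_one pm_mul.
Proof. by move=> [s u]; rewrite /pm_mul /= expr0 mul1r addr0. Qed.

Lemma pm_mulg1 : right_id pm_one pm_mul.
Proof. by move=> [s u]; rewrite /pm_mul /= addbF mulr0 add0r. Qed.

Lemma pm_mulVg : left_inverse pm_one pm_inv pm_mul.
Proof. by move=> [s u]; rewrite /pm_mul /= addbb subrr. Qed.

Lemma pm_mulgV : right_inverse pm_one pm_inv pm_mul.
Proof. by move=> [s u]; rewrite /pm_mul /= addbb mulrN signrMK addNr. Qed.

HB.instance Definition _ := isGroup.Build (pm_motion C)
  pm_mulA pm_mul1 pm_mulg1 pm_mulVg pm_mulgV.
End PmMotion.

(** * Linear extension from a group to its group algebra *)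

Definition lin_ext (C : nzRingType) (G : groupType) (V : lmodType C)
    (f : G -> V) (a : group_algebra C G) : V :=
  \sum_(g <- msupp a) a@_g *: f g.

Section LinExt.
Context (C : nzRingType) (G : groupType) (V : lmodType C) (f : G -> V).

Lemma lin_extU x g : lin_ext f << x *g g >> = x *: f g.
Proof. by apply: (gsumU (F := fun g x => x *: f g)) => h; rewrite scale0r. Qed.

Lemma lin_ext_linear : linear (lin_ext f).
Proof.
move=> c a b; rewrite /lin_ext (gsumD (F := fun g x => x *: f g)).
- rewrite (gsumZ (F := fun g x => x *: f g)); last by move=> h; rewrite scale0r.
  by rewrite scaler_sumr; congr (_ + _); apply: eq_bigr => g _; rewrite scalerA.
- by move=> h; rewrite scale0r.
- by move=> h x y; rewrite scalerDl.
Qed.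

HB.instance Definition _ := GRing.isLinear.Build C (group_algebra C G) V _
  (lin_ext f) lin_ext_linear.
End LinExt.

Lemma malg_ext2 (C : nzRingType) (G : groupType) (V : zmodType)
    (f1 f2 : group_algebra C G -> group_algebra C G -> V) :
  (forall b, {morph f1^~ b : a a' / a + a'}) ->
  (forall a, {morph f1 a : b b' / b + b'}) ->
  (forall b, {morph f2^~ b : a a' / a + a'}) ->
  (forall a, {morph f2 a : b b' / b + b'}) ->
  (forall x g y h, f1 << x *g g >> << y *g h >> = f2 << x *g g >> << y *g h >>) ->
  forall a b, f1 a b = f2 a b.
Proof.
move=> f1Dl f1Dr f2Dl f2Dr f12 a b; move: a.
apply: (malg_ext (f1Dl b) (f2Dl b)) => x g; move: b.
by apply: (malg_ext (f1Dr _) (f2Dr _)) => y h.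
Qed.

(** * Schürmann triples on group algebras *)
Section Obstruction.
Context (C : numClosedFieldType) (G : groupType).
Notation A := (group_algebra C G).
Context (D : lmodType C) (ip : {dot D for Num.conj}) (pi : A -> D -> D)
  (eta : A -> D) (psi : A -> C)
  (triple : schurmann_triple (@augmentation C G) ip pi eta psi).
Let u (g : G) : A := << g >>.

Lemma schurmann_groupM g h :
  psi (u (g * h)%g) = psi (u g) + psi (u h) + inner ip (eta (u g^-1%g)) (eta (u h)).
Proof.
case: triple => _ _ _ _ /(_ (u g) (u h)).
rewrite (gmulrUU 1 1) [star _]gstarU conjC1 mulr1 !augmentationU mul1r mulr1.
by move=> e; rewrite -[inner _ _ _]opprK -e; ring.
Qed.

Lemma schurmann_group1 : eta (u 1%g) = 0 /\ psi (u 1%g) = 0.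
Proof.
have eta1 : eta (u 1%g) = 0.
  case: triple => -[_ _ pi1 _] [_ /(_ 1 1)] + _ _ _.
  rewrite mulr1 pi1 augmentation1 scale1r => e.
  by apply: (addrI (eta 1)); rewrite -e addr0.
split=> //; have := schurmann_groupM 1%g 1%g.
rewrite mulg1 invg1 eta1 /inner raddf0 addr0 => e.
by apply: (addrI (psi (u 1%g))); rewrite -e addr0.
Qed.

(** Since eta vanishes at 1, the cocycle identity at g^-1 * g determines
eta(g^-1) from eta(g). *)
Lemma schurmann_group_inv0 g : eta (u g) = 0 -> eta (u g^-1%g) = 0.
Proof.
move=> eta_g0; case: triple => -[adj _ _ _] [_ /(_ (u g^-1%g) (u g))] + _ _ _.
rewrite (gmulrUU 1 1) mulVg mulr1 schurmann_group1.1 eta_g0 augmentationU.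
have [/zmod_morphism_linear/(_ 0 0) + _] := adj (u g^-1%g).
by rewrite !subrr => ->; rewrite add0r scale1r => <-.
Qed.

Lemma schurmann_groupM0 g h : eta (u g) = 0 ->
  psi (u (g * h)%g) = psi (u g) + psi (u h).
Proof.
move=> /schurmann_group_inv0 eta_g; rewrite schurmann_groupM eta_g.
by rewrite /inner raddf0 addr0.
Qed.

(** Compare psi on g * h and on h * g: they differ by the commutator, where psi
is additive since eta vanishes there. *)
Lemma schurmann_group_comm g h : eta (u (lcommg g h)) = 0 ->
  psi (u (lcommg g h)) = inner ip (eta (u g^-1%g)) (eta (u h))
                         - inner ip (eta (u h^-1%g)) (eta (u g)).
Proof.
move=> eta_gh; have := schurmann_groupM0 (h * g)%g eta_gh.
rewrite (_ : lcommg g h * (h * g) = g * h)%g; last first.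
  by rewrite /lcommg -!mulgA (mulgA h^-1%g) mulVg mul1g mulVg mulg1.
by rewrite !schurmann_groupM => e; apply: (addIr (psi (u h) + psi (u g)
  + inner ip (eta (u h^-1%g)) (eta (u g)))); rewrite -e; ring.
Qed.

Lemma schurmann_group_prod (I : Type) (s : seq I) (g : I -> G) :
  (forall i, eta (u (g i)) = 0) ->
  psi (u (\prod_(i <- s) g i)%g) = \sum_(i <- s) psi (u (g i)).
Proof.
move=> eta_g; elim: s => [|i s IHs]; first by rewrite !big_nil schurmann_group1.2.
by rewrite !big_cons schurmann_groupM0 // IHs.
Qed.
End Obstruction.

(** The pairing of the 2-cocycle of eta with the fundamental class of the
surface: both sides compute psi on the relator, which is 1 in the group. *)
Lemma surface_obstruction (C : numClosedFieldType) (k : nat)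
    (D : lmodType C) (ip : {dot D for Num.conj})
    (pi : group_algebra C (surface_group k) -> D -> D)
    (eta : group_algebra C (surface_group k) -> D)
    (psi : group_algebra C (surface_group k) -> C)
    (a := fun i => surface_gen (i, false)) (b := fun i => surface_gen (i, true)) :
  schurmann_triple (@augmentation C (surface_group k)) ip pi eta psi ->
  (forall i, eta << lcommg (a i) (b i) >> = 0) ->
  \sum_(i < k) (inner ip (eta << (a i)^-1%g >>) (eta << b i >>)
              - inner ip (eta << (b i)^-1%g >>) (eta << a i >>)) = 0.
Proof.
move=> triple eta_ab.
rewrite -[RHS](schurmann_group1 triple).2 -surface_relation.
rewrite (schurmann_group_prod triple) // big_enum /=.
by apply: eq_bigr => i _; rewrite (schurmann_group_comm triple (eta_ab i)).
Qed.

(** * The one-dimensional inner product space *)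
Section StandardForm.
Context (C : numClosedFieldType).

Definition conj_form (x y : C^o) : C := x * y^*.

Lemma conj_form_bilinear :
  bilinear_for *%R (Num.conj \; *%R : C -> C -> C) conj_form.
Proof.
split=> [y c x x'|x c y y'] /=; rewrite /conj_form.
  by rewrite mulrDl -mulrA.
by rewrite rmorphD rmorphM mulrDr mulrCA.
Qed.

HB.instance Definition _ := bilinear_isBilinear.Build C C^o C^o C _ _ conj_form
  conj_form_bilinear.

Lemma conj_form_hermitian x y :
  conj_form x y = (-1) ^+ false * Num.conj (conj_form y x).
Proof. by rewrite /conj_form expr0 mul1r rmorphM /= conjCK mulrC. Qed.

HB.instance Definition _ := isHermitianSesquilinear.Build C C^o false Num.conj
  conj_form conj_form_hermitian.

Lemma conj_form_gt0 x : x != 0 -> 0 < conj_form x x.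
Proof. by move=> x0; rewrite /conj_form mul_conjC_gt0. Qed.

HB.instance Definition _ := isDotProduct.Build C C^o conj_form conj_form_gt0.

Definition conj_dot : {dot C^o for Num.conj} := conj_form.

Lemma ip_norm_conj_dot (x : C^o) : ip_norm conj_dot x = `|x|.
Proof. by rewrite /ip_norm /inner /= /conj_form -normCK sqrCK. Qed.
End StandardForm.

(** * The representation and the cocycle of a group of motions *)
Section Motion.
Context (C : numClosedFieldType) (G : groupType) (phi : G -> pm_motion C)
  (phiM : forall g h, phi (g * h)%g = (phi g * phi h)%g).
Notation A := (group_algebra C G).

Definition motion_char : A -> C^o :=
  lin_ext (fun g => (-1) ^+ (phi g).1 : C^o).
Definition motion_rep (a : A) (v : C^o) : C^o := motion_char a * v.
Definition motion_cocycle : A -> C^o := lin_ext (fun g => (phi g).2 : C^o).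

HB.instance Definition _ := GRing.Linear.on motion_char.
HB.instance Definition _ := GRing.Linear.on motion_cocycle.

Lemma motion1 : phi 1%g = 1%g.
Proof. by apply: (mulgI (phi 1%g)); rewrite -phiM !mulg1. Qed.

Lemma motionV g : phi g^-1%g = (phi g)^-1%g.
Proof. by apply: (mulgI (phi g)); rewrite -phiM !mulgV motion1. Qed.

Lemma motion_charM a b : motion_char (a * b) = motion_char a * motion_char b.
Proof.
apply: (malg_ext2 (f1 := fun a b => motion_char (a * b))
                  (f2 := fun a b => motion_char a * motion_char b)).
- by move=> {}b a1 a2; rewrite mulrDl linearD.
- by move=> {}a b1 b2; rewrite mulrDr linearD.
- by move=> {}b a1 a2; rewrite linearD mulrDl.
- by move=> {}a b1 b2; rewrite linearD mulrDr.
move=> x g y h; rewrite gmulrUU /motion_char !lin_extU phiM /= signr_addb.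
by rewrite -scalerAl -[in RHS]scalerAr [RHS]scalerA.
Qed.

Lemma motion_char_star a : motion_char (star a) = (motion_char a)^*.
Proof.
move: a; apply: malg_ext => [a b|a b|x g]; rewrite ?starD ?linearD ?rmorphD //.
rewrite [star _]gstarU /motion_char !lin_extU motionV /=.
by rewrite rmorphM rmorph_sign.
Qed.

Lemma motion_rep_star : unital_star_rep (conj_dot C) motion_rep.
Proof.
have pi_lin a : linear (motion_rep a).
  by move=> c u v; rewrite /motion_rep mulrDr scalerAr.
split=> [a|c a b v|v|a b v].
- split; [exact: pi_lin|split; [exact: pi_lin|move=> u v]].
  rewrite /inner /= /conj_form /motion_rep motion_char_star rmorphM.
  by rewrite mulrCA mulrA.
- by rewrite /motion_rep linearP mulrDl scalerAl.
- by rewrite /motion_rep [motion_char 1]lin_extU motion1 scale1r mul1r.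
- by rewrite /motion_rep motion_charM mulrA.
Qed.

Lemma motion_cocycleP : cocycle (@augmentation C G) motion_rep motion_cocycle.
Proof.
split=> [c a b|a b]; first by rewrite linearP.
apply: (malg_ext2 (f1 := fun a b => motion_cocycle (a * b))
  (f2 := fun a b => motion_rep a (motion_cocycle b)
                    + augmentation b *: motion_cocycle a)).
- by move=> {}b a1 a2; rewrite mulrDl linearD.
- by move=> {}a b1 b2; rewrite mulrDr linearD.
- move=> {}b a1 a2; rewrite /motion_rep !linearD mulrDl /=; exact: addrACA.
- move=> {}a b1 b2; rewrite /motion_rep !linearD scalerDl mulrDr /=.
  exact: addrACA.
move=> x g y h; rewrite gmulrUU /motion_rep /motion_cocycle /motion_char.
rewrite !lin_extU augmentationU phiM /=.
by rewrite scalerDr -scalerAl -scalerAr !scalerA [y * x]mulrC.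
Qed.

(** As h moves the origin, eta is onto the line; as g reverses the sign,
pi(g) - eps(g) = -2. Hence only 0 is orthogonal to the range of
pi(g) - eps(g). *)
Lemma motion_non_gaussian (g h : G) :
  ip_complete (conj_dot C) -> (phi g).1 -> (phi h).2 != 0 ->
  non_gaussian (@augmentation C G) (conj_dot C) motion_rep motion_cocycle.
Proof.
move=> complete flip trans.
have eta_surj v : range motion_cocycle v.
  exists << v / (phi h).2 *g h >> => //.
  by rewrite /motion_cocycle lin_extU; exact: divfK.
have HG0 : gaussian_space (@augmentation C G) motion_rep motion_cocycle
             (conj_dot C) id = [set 0]%classic.
  apply/seteqP; split=> [w /(_ << g >> 1 (eta_surj 1))|_ -> a v _].
    rewrite /motion_rep /motion_char lin_extU augmentationU flip.
    rewrite /inner /= /conj_form !scale1r expr1 mulr1 => /eqP.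
    rewrite mulf_eq0 conjC_eq0 => /orP[/eqP //|].
    by rewrite -opprD oppr_eq0 (_ : 1 + 1 = 2%:R) // pnatr_eq0.
  by rewrite /inner /= /conj_form mul0r.
(* The line is complete, hence its own completion, and the projection onto the
   zero space is zero. *)
exists C^o, (conj_dot C), id, (fun=> 0); split.
- split=> // x e e0; exists x; first exact: eta_surj.
  by rewrite ip_norm_conj_dot subrr normr0.
- rewrite HG0 => x; split=> // y ->.
  by rewrite /inner /= /conj_form conjC0 mulr0.
- apply/seteqP; split=> [_ [v _ <-] //|_ ->].
  by exists 0; first exact: eta_surj.
Qed.
End Motion.

(** * The motions attached to a surface group *)
Section Surface.
Context (C : numClosedFieldType) (k : nat).

(** The handle 0 carries the reflection and the handle 1 two translations that
span the plane over the reals; within each handle the two images commute, so the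
relator is respected. *)
Definition surface_motion_gen (x : 'I_k * bool) : pm_motion C :=
  if x.1 == 0 :> nat then (~~ x.2, 0)
  else if x.1 == 1 :> nat then (false, if x.2 then 'i else 1)
  else (false, 0).

Lemma surface_motion_gen_comm i :
  lcommg (surface_motion_gen (i, false)) (surface_motion_gen (i, true)) = 1%g.
Proof.
rewrite /surface_motion_gen /=; case: eqP => _; last case: eqP => _.
- by congr pair => /=; ring.
- by congr pair => /=; ring.
- by congr pair => /=; ring.
Qed.

Definition surface_motion : surface_group k -> pm_motion C :=
  presented_lift surface_motion_gen.

Lemma surface_motion_rel r : [set surface_relator k]%classic r ->
  word_eval surface_motion_gen r = 1%g.
Proof.
move=> ->; rewrite word_eval_surface_relator big1 // => i _.
exact: surface_motion_gen_comm.
Qed.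

Lemma surface_motionM (g h : surface_group k) :
  surface_motion (g * h)%g = (surface_motion g * surface_motion h)%g.
Proof. exact: presented_liftM surface_motion_rel g h. Qed.

Lemma surface_motionE x : surface_motion (surface_gen x) = surface_motion_gen x.
Proof. exact: presented_lift_gen surface_motion_rel x. Qed.

End Surface.

(** * Completeness of the complex numbers *)
Local Open Scope complex_scope.

(** The limit is the lower limit, obtained as the supremum of the eventual lower
bounds. *)
Lemma real_cauchy_cvg (R : realType) (u : nat -> R) :
  (forall e, 0 < e -> exists N, forall m n, (N <= m)%N -> (N <= n)%N ->
     `|u m - u n| < e) ->
  exists l, forall e, 0 < e -> exists N, forall n, (N <= n)%N -> `|u n - l| < e.
Proof.
move=> cau; pose S := [set x | exists N, forall n, (N <= n)%N -> x <= u n]%classic.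
have near N e : (forall m n, (N <= m)%N -> (N <= n)%N -> `|u m - u n| < e) ->
    S (u N - e) /\ ubound S (u N + e).
  move=> uN; split.
    exists N => n Nn; have := uN n N Nn (leqnn N); rewrite ltr_norml; lra.
  move=> x [M xM]; have := uN (maxn M N) N (leq_maxr _ _) (leqnn N).
  have := xM (maxn M N) (leq_maxl _ _); rewrite ltr_norml; lra.
have hS : has_sup S.
  have [N /near[S1 S2]] := cau 1 ltr01.
  by split; [exists (u N - 1)|exists (u N + 1)].
exists (sup S) => e e0; have e20 : 0 < e / 2 by rewrite divr_gt0.
have [N uN] := cau _ e20; exists N => n Nn.
have [S1 S2] := near N _ uN.
have := sup_upper_bound hS S1; have := ge_sup hS.1 S2.
have := uN n N Nn (leqnn N); rewrite !ltr_norml; lra.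
Qed.

Lemma normc_ge_Im (R : rcfType) (x : R[i]) : `|complex.Im x|%:C <= `|x|.
Proof.
by case: x => a b; simpc; rewrite -sqrtr_sqr ler_wsqrtr // lerDr sqr_ge0.
Qed.

Lemma complex_complete (R : realType) : ip_complete (conj_dot R[i]).
Proof.
move=> u cau.
have part (p : R[i] -> R) : {morph p : x y / x - y} ->
    (forall x, `|p x|%:C <= `|x|) ->
    exists l, forall e, 0 < e ->
      exists N, forall n, (N <= n)%N -> `|p (u n) - l| < e.
  move=> pB p_le; apply: real_cauchy_cvg => e e0.
  have [|N uN] := cau e%:C; first by rewrite ltcR.
  exists N => m n Nm Nn; rewrite -pB -ltcR; apply: le_lt_trans (p_le _) _.
  by have := uN m n Nm Nn; rewrite ip_norm_conj_dot.
have [|a ua] := part (@complex.Re R) _ (@normc_ge_Re R); first by case=> ? ? [].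
have [|b ub] := part (@complex.Im R) _ (@normc_ge_Im R); first by case=> ? ? [].
exists (a +i* b) => -[e e'] /[dup]; rewrite ltcE /= => /andP[/eqP -> e0] _.
have e20 : 0 < e / 2 by rewrite divr_gt0.
have [N1 uN1] := ua _ e20; have [N2 uN2] := ub _ e20.
exists (maxn N1 N2) => n; rewrite geq_max => /andP[/uN1 + /uN2].
rewrite ip_norm_conj_dot.
have -> : u n - (a +i* b) = (complex.Re (u n) - a)%:C +
                             'i * (complex.Im (u n) - b)%:C.
  by case: (u n) => x y; simpc.
move=> n1 n2; apply: le_lt_trans (ler_normD _ _) _.
have normR (x : R) : `|x%:C| = `|x|%:C.
  by rewrite normc_def /= expr0n /= addr0 sqrtr_sqr.
rewrite normrM !normR.
have -> : `|'i : R[i]| = 1 by rewrite normc_def /= expr0n expr1n add0r sqrtr1.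
by rewrite mul1r -rmorphD ltcR; lra.
Qed.

(** * Failure of property (NC) *)

Theorem proposition4p2 (R : realType) (k : nat) (hk : (2 <= k)%N) :
  ~ property_NC (@augmentation R[i] (surface_group k)).
Proof.
set phi := surface_motion R[i] (k := k).
have phiM : forall g h, phi (g * h)%g = (phi g * phi h)%g.
  exact: surface_motionM.
pose i0 := Ordinal (ltnW hk); pose i1 := Ordinal hk.
have phiE x : phi (surface_gen x) = surface_motion_gen R[i] x.
  exact: surface_motionE.
have etaU g : motion_cocycle phi << g >> = (phi g).2.
  by rewrite /motion_cocycle lin_extU scale1r.
move=> /(_ _ _ _ _ (motion_rep_star phiM) (motion_cocycleP phiM)) [].
  apply: (motion_non_gaussian (g := surface_gen (i0, false))
    (h := surface_gen (i1, false))); first exact: complex_complete.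
  - by rewrite phiE.
  - by rewrite phiE oner_neq0.
move=> psi triple.
have eta_comm i : motion_cocycle phi
    << lcommg (surface_gen (i, false)) (surface_gen (i, true)) >> = 0.
  rewrite etaU /lcommg !phiM !(motionV phiM) !phiE.
  by rewrite -/(lcommg _ _) surface_motion_gen_comm.
have /eqP := surface_obstruction triple eta_comm.
(* Only the handle of the two translations contributes, by -2i. *)
rewrite (bigD1 i1) //= big1 => [|i ii1]; last first.
  rewrite !etaU !(motionV phiM) !phiE /surface_motion_gen /=.
  have /negPf -> : i != 1%N :> nat by [].
  by case: eqP => _; rewrite /inner /= /conj_form !mul0r subrr.
rewrite !etaU !(motionV phiM) !phiE /surface_motion_gen /=.
rewrite /inner /= /conj_form.
rewrite addr0 expr0 !mul1r !rmorphN /= conjC1 conjCi opprK mulrN1 -mulr2n.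
by rewrite mulrn_eq0 oppr_eq0 (negPf (neq0Ci _)).
Qed.
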